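(* For every integer $n\ge0$, \[ t^{1/2}(2,\{1\}^n,2)=\frac{n+3}{2^{n+2}}\,t(n+4)=\frac{n+3}{2^{n+2}}\Big(1-\frac{1}{2^{n+4}}\Big)\zeta(n+4). \]
   Context: For positive integers $s_1,\dots,s_d$ (with $s_d\ge2$) and $r\in\mathbb{R}$, the interpolated multiple $t$-value is $t^r(s_1,\dots,s_d)=\sum_{1\le n_1\le\cdots\le n_d}\frac{r^{\delta_{n_1,n_2}+\cdots+\delta_{n_{d-1},n_d}}}{(2n_1-1)^{s_1}\cdots(2n_d-1)^{s_d}}$, where $\delta_{a,b}$ is the Kronecker delta; $t(k)=\sum_{m\ge1}(2m-1)^{-k}$. $\{1\}^n$ denotes $n$ repetitions of $1$. $\zeta$ is the Riemann zeta function. *)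

(* Defs.v *)
From mathcomp Require Export all_boot all_order all_algebra.
From mathcomp Require Export all_classical all_reals all_analysis.

Set Implicit Arguments.
Unset Strict Implicit.
Unset Printing Implicit Defensive.

Export Order.TTheory GRing.Theory Num.Theory.
Export numFieldNormedType.Exports.

Local Open Scope classical_set_scope.
Local Open Scope ring_scope.

Section interpolated_t_values.
Context {R : realType}.

Definition mtv_index (d : nat) : set (d.-tuple nat) :=
  [set n : d.-tuple nat | all (leq 1) n && sorted leq n].

(* The exponent counts the i with n_i = n_(i+1); positions are numbered from 0. *)
Definition mtv_term (r : R) (d : nat) (s n : d.-tuple nat) : R :=
  r ^+ (\sum_(i < d.-1) (nth 0 n i == nth 0 n i.+1))%N /
  \prod_(i < d) (2 * (tnth n i)%:R - 1) ^+ tnth s i.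

(* [\esum] is a supremum of finite partial sums, hence only meaningful for
   nonnegative families. As r may be negative, the multiple series is summed as
   the difference of its positive and negative parts, which is its usual value
   whenever it converges absolutely. The result is finite exactly when the
   series converges absolutely (+oo - +oo is -oo here). *)
Definition mtv (r : R) (d : nat) (s : d.-tuple nat) : \bar R :=
  (\esum_(n in @mtv_index d) (EFin \o mtv_term r s)^\+ n -
   \esum_(n in @mtv_index d) (EFin \o mtv_term r s)^\- n)%E.

(* The library's series start at index 0, whence m.+1 for m >= 1. *)
Definition tvalue (k : nat) : R :=
  limn (series (fun m : nat => ((2 * m.+1%:R - 1) ^+ k)^-1 : R)).

(* The Riemann zeta function on the half-line s > 1; [riemannR s] is the
   sequence (m + 1)^(-s), m = 0, 1, ... *)
Definition zeta (s : R) : R := limn (series (riemannR s)).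

End interpolated_t_values.

(* Main.v *)
Require Import Defs.
From mathcomp Require Import measurable_realfun zify ring lra.

(** Put [rho s = sqrt (1 + e^(2 s))], [theta s = arcsinh (e^s)] and
    [tau s = tanh (theta s / 2)].  Since [tau' = tau / rho] and
    [rho = (1 + tau^2) / (1 - tau^2)], integrating a power series
    [sum_j c_j tau^(2 j + 1)] from [-oo] to [s] replaces [c_j] by
    [(c_j + 2 sum_(i < j) c_i) / (2 j + 1)]: up to a power of 2 this appends one
    argument 1 to the interpolated value at 1/2.  Hence the value sought is, up
    to a power of 2, [T_(n+1) (0)], where
    [T_m (x) = int Phi_m (s - x) / rho s ds] and [Phi_m] is the [m]-th iterated
    integral of [Phi_0 = int theta / rho].  Because translations commute with
    integration, Tonelli gives [T_m (x) = int_(v >= x) T_(m-1) (v) dv], so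
    everything reduces to [T_(-1)], the correlation of [theta / rho] with
    [1 / rho].  Its derivative is an elementary integral:
    [- T_(-1)' (v) = v / (2 sinh v) = sum_j v e^(- (2 j + 1) v)], and iterated
    integration of these terms produces [(n + 3) / (2 j + 1)^(n + 4)]. *)

Local Open Scope classical_set_scope.
Local Open Scope ring_scope.

Set Implicit Arguments.
Unset Strict Implicit.
Unset Printing Implicit Defensive.

(** * The functions rho, tau and theta *)

Section calculus.
Context {R : realType}.
Implicit Types (s v x : R).

Definition rho s : R := Num.sqrt (1 + expR s ^+ 2).
(** The half-angle formula [sinh / (1 + cosh)] for tanh, since [sinh (theta s) = expR s] and
    [cosh (theta s) = rho s]. *)
Definition tau s : R := expR s / (1 + rho s).
Definition theta s : R := ln (expR s + rho s).

Lemma rho_sqr s : rho s ^+ 2 = 1 + expR s ^+ 2.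
Proof. by rewrite sqr_sqrtr// addr_ge0// sqr_ge0. Qed.

Lemma rho_gt1 s : 1 < rho s.
Proof.
by rewrite -[ltLHS]sqrtr1 ltr_sqrt ?ltrDl ?addr_gt0 ?exprn_gt0 ?expR_gt0.
Qed.

Lemma rho_gt0 s : 0 < rho s.
Proof. exact: lt_trans (rho_gt1 s). Qed.

Lemma rho_neq0 s : rho s != 0. Proof. by rewrite gt_eqF// rho_gt0. Qed.

Lemma rho1_neq0 s : 1 + rho s != 0.
Proof. by rewrite gt_eqF// addr_gt0// rho_gt0. Qed.

Lemma tau_gt0 s : 0 < tau s.
Proof. by rewrite divr_gt0 ?expR_gt0// addr_gt0// rho_gt0. Qed.

Lemma expR_lt_rho s : expR s < rho s.
Proof.
rewrite -(@ltr_pXn2r _ 2)// ?nnegrE ?expR_ge0 ?(ltW (rho_gt0 s))//.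
by rewrite rho_sqr ltrDr.
Qed.

Lemma tau_lt1 s : tau s < 1.
Proof.
rewrite ltr_pdivrMr ?mul1r ?addr_gt0 ?rho_gt0//.
by rewrite (lt_trans (expR_lt_rho s))// ltrDr.
Qed.

Lemma tau_sqr_lt1 s : tau s ^+ 2 < 1.
Proof. by rewrite expr_lt1// ?tau_lt1// ltW// tau_gt0. Qed.

Lemma expR_tau s : expR s = 2 * tau s / (1 - tau s ^+ 2).
Proof.
have h : 1 - tau s ^+ 2 != 0 by rewrite gt_eqF// subr_gt0 tau_sqr_lt1.
apply/esym/(canLR (mulfK h))/eqP; rewrite -subr_eq0 /tau; apply/eqP.
(* [field] does not know [rho_sqr], so the difference is exhibited as a multiple of
   [1 + expR s ^+ 2 - rho s ^+ 2]. *)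
transitivity (expR s / (1 + rho s) ^+ 2 *
    (1 + expR s ^+ 2 - rho s ^+ 2)); last by rewrite rho_sqr subrr mulr0.
by field; exact: rho1_neq0.
Qed.

Lemma rho_tau s : rho s = (1 + tau s ^+ 2) / (1 - tau s ^+ 2).
Proof.
have h : 1 - tau s ^+ 2 != 0 by rewrite gt_eqF// subr_gt0 tau_sqr_lt1.
apply/esym/(canLR (mulfK h))/eqP; rewrite -subr_eq0 /tau; apply/eqP.
transitivity ((1 + rho s)^-1 *
    (1 + expR s ^+ 2 - rho s ^+ 2)); last by rewrite rho_sqr subrr mulr0.
by field; exact: rho1_neq0.
Qed.

Lemma theta_ge0 s : 0 <= theta s.
Proof.
apply: ln_ge0; rewrite (le_trans (ltW (rho_gt1 s)))// lerDr expR_ge0 //.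
Qed.

(** Derivation rules for lambda-abstracted functions. The value [c] is tied by an equation: [erefl]
    keeps the computed derivative, any other proof simplifies it. *)
Lemma is_derive1D (f g : R -> R) x (a b c : R) :
  is_derive x 1 f a -> is_derive x 1 g b -> a + b = c ->
  is_derive x 1 (fun y => f y + g y) c.
Proof. by move=> ? ? <-; exact: is_deriveD. Qed.

Lemma is_derive1M (f g : R -> R) x (a b c : R) :
  is_derive x 1 f a -> is_derive x 1 g b -> f x * b + g x * a = c ->
  is_derive x 1 (fun y => f y * g y) c.
Proof. by move=> ? ? <-; exact: is_deriveM. Qed.

Lemma is_derive1V (f : R -> R) x (a c : R) : f x != 0 ->
  is_derive x 1 f a -> - a / f x ^+ 2 = c ->
  is_derive x 1 (fun y => (f y)^-1) c.
Proof.
move=> f0 df <-; apply: (is_derive_eq (is_deriveV f0 df)).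
by rewrite scaleNr mulNr [_ *: _]mulrC.
Qed.

Lemma is_derive1X (f : R -> R) n x (a c : R) :
  is_derive x 1 f a -> n%:R * f x ^+ n.-1 * a = c ->
  is_derive x 1 (fun y => f y ^+ n) c.
Proof.
move=> df <-; rewrite [X in is_derive _ _ X _](_ : _ = f ^+ n).
  exact: is_deriveX.
by apply/funext => y; rewrite fctE.
Qed.

Lemma is_derive1_comp_eq (f g : R -> R) x (a b c : R) :
  is_derive x 1 g b -> is_derive (g x) 1 f a -> a * b = c ->
  is_derive x 1 (fun y => f (g y)) c.
Proof. by move=> ? ? <-; exact: is_derive1_comp. Qed.

Lemma is_derive1_addr (f : R -> R) x v (a : R) :
  is_derive (x + v) 1 f a -> is_derive x 1 (fun y => f (y + v)) a.
Proof.
by move=> df; exact: (is_derive1_comp_eq (is_derive_shift _ _ _) df (mulr1 _)).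
Qed.

Lemma is_derive1_addl (f : R -> R) x v (a : R) :
  is_derive (x + v) 1 f a -> is_derive v 1 (fun y => f (x + y)) a.
Proof.
rewrite addrC => /is_derive1_addr; congr is_derive.
by apply/funext => y; rewrite addrC.
Qed.

Lemma is_derive1_subl (f : R -> R) x v (a : R) :
  is_derive (x - v) 1 f a -> is_derive v 1 (fun y => f (x - y)) (- a).
Proof.
move=> /is_derive1_addl df.
exact: (is_derive1_comp_eq (is_deriveNid _ _) df (mulrN1 _)).
Qed.

Lemma is_derive_rho s : is_derive s 1 rho (expR s ^+ 2 / rho s).
Proof.
have h : 0 < 1 + expR s ^+ 2 by rewrite addr_gt0// exprn_gt0// expR_gt0.
have d2 := is_derive1X (is_derive_expR s) (erefl (2%:R * expR s ^+ 1 * expR s)).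
have d := is_derive1D (is_derive_cst (1 : R^o) s 1) d2 (add0r _).
have /= := is_derive1_comp_eq d (is_derive1_sqrt h) erefl.
rewrite -/(rho s) => /is_derive_eq; apply; rewrite expr1.
by field; exact: rho_neq0.
Qed.

Lemma is_derive_tau s : is_derive s 1 tau (tau s / rho s).
Proof.
apply: is_derive1M.
  apply: is_derive1V; first exact: rho1_neq0.
    exact: (is_derive1D (is_derive_cst (1 : R^o) s 1) (is_derive_rho s)
      (add0r _)).
  by [].
(* Trading [expR s ^+ 2] for [rho s ^+ 2 - 1] lets a factor [1 + rho s] cancel. *)
rewrite /tau -[X in - (X / _)](addrK 1) [X in - ((X - _) / _)]addrC -rho_sqr.
by field; rewrite rho_neq0 rho1_neq0.
Qed.

Lemma is_derive_theta s : is_derive s 1 theta (expR s / rho s).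
Proof.
have h : 0 < expR s + rho s by rewrite addr_gt0 ?expR_gt0 ?rho_gt0.
have d := is_derive1D (is_derive_expR s) (is_derive_rho s) erefl.
apply: (is_derive_eq (is_derive1_comp_eq d (is_derive1_ln h) erefl)).
by field; rewrite rho_neq0 (gt_eqF h).
Qed.

Lemma is_derive1_continuous (f df : R -> R) :
  (forall x, is_derive x 1 f (df x)) -> continuous f.
Proof.
by move=> h x; apply/differentiable_continuous/derivable1_diffP; case: (h x).
Qed.

Lemma continuous_rho : continuous rho.
Proof. exact: is_derive1_continuous is_derive_rho. Qed.

Lemma continuous_tau : continuous tau.
Proof. exact: is_derive1_continuous is_derive_tau. Qed.

Lemma continuous_theta : continuous theta.
Proof. exact: is_derive1_continuous is_derive_theta. Qed.

Lemma cvg_expRNy : expR x @[x --> -oo] --> (0 : R).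
Proof. exact/cvgNy_compNP/cvgr_expR. Qed.

Lemma tau_le s : tau s <= expR s.
Proof.
rewrite ler_pdivrMr ?addr_gt0 ?rho_gt0// ler_peMr ?expR_ge0//.
by rewrite lerDl ltW// rho_gt0.
Qed.

Lemma cvg_tauNy : tau x @[x --> -oo] --> (0 : R).
Proof.
apply: (squeeze_cvgr _ (cvg_cst 0) cvg_expRNy).
by apply: nearW => x; rewrite ltW ?tau_gt0// tau_le.
Qed.

Lemma rho_lt s : rho s < 1 + expR s.
Proof.
rewrite -(@ltr_pXn2r _ 2)// ?nnegrE ?addr_ge0 ?expR_ge0 ?(ltW (rho_gt0 s))//.
by rewrite rho_sqr sqrrD expr1n mul1r ltrD2r ltrDl mulrn_wgt0// expR_gt0.
Qed.

Lemma tau_ge s : 1 - 2 * expR (- s) <= tau s.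
Proof.
have e0 := expR_gt0 s; have r0 := rho_gt0 s; have re := rho_lt s.
have er := expR_lt_rho s.
rewrite expRN ler_pdivlMr ?addr_gt0// -(@ler_pM2r _ (expR s))//.
have -> : (1 - 2 * (expR s)^-1) * (1 + rho s) * expR s =
  (expR s - 2) * (1 + rho s) by field; rewrite gt_eqF.
nra.
Qed.

Lemma cvg_tauy : tau x @[x --> +oo] --> (1 : R).
Proof.
apply: (@squeeze_cvgr _ _ _ _ (fun x => 1 - 2 * expR (- x)) (cst 1)).
- by apply: nearW => x; rewrite tau_ge ltW// tau_lt1.
- rewrite -[X in _ --> X]subr0 -(mulr0 2).
  by apply: cvgB; [exact: cvg_cst|apply: cvgMr; exact: cvgr_expR].
- exact: cvg_cst.
Qed.

Lemma theta_le s : theta s <= 2 * expR s.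
Proof.
have e0 := expR_gt0 s; have r0 := rho_gt0 s; have re := rho_lt s.
apply: (@le_trans _ _ (ln (1 + 2 * expR s))).
  by rewrite ler_ln ?posrE ?addr_gt0 ?mulr_gt0//; lra.
by apply: le_ln1Dx; lra.
Qed.

Lemma cvg_thetaNy : theta x @[x --> -oo] --> (0 : R).
Proof.
apply: (@squeeze_cvgr _ _ _ _ (cst 0) (fun x => 2 * expR x)).
- by apply: nearW => x; rewrite theta_ge0 theta_le.
- exact: cvg_cst.
- by rewrite -(mulr0 2); apply: cvgMr; exact: cvg_expRNy.
Qed.

Lemma theta_bounds s : s + ln 2 <= theta s <= s + ln 2 + expR (- s).
Proof.
have e0 := expR_gt0 s; have r0 := rho_gt0 s; have re := rho_lt s.
have er := expR_lt_rho s; have ee := expRN s.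
have f0 := expR_gt0 (- s).
have fe : expR (- s) * expR s = 1 by rewrite ee mulVf// gt_eqF.
(* The last logarithm has its argument between 1 and [1 + expR (- s)], because
   [expR s < rho s < 1 + expR s]. *)
have -> : theta s = s + ln 2 + ln ((expR s + rho s) * expR (- s) / 2).
  rewrite !lnM ?posrE ?invr_gt0 ?mulr_gt0 ?addr_gt0// expRK lnV ?posrE//.
  by rewrite /theta; lra.
rewrite lerDl lerD2l; apply/andP; split.
  by apply: ln_ge0; nra.
apply: (@le_trans _ _ (ln (1 + expR (- s)))).
  by rewrite ler_ln ?posrE ?divr_gt0 ?mulr_gt0 ?addr_gt0//; nra.
by apply: le_ln1Dx; lra.
Qed.

End calculus.

(** * Integrals over half-lines and over the line *)

Section integrals.
Context {R : realType}.
Implicit Types (f F : R -> R) (x y : R).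
Notation mu := (@lebesgue_measure R).

(** The primitive has the opposite sign, so that [F] is directly the tail integral of [f].
    Nonnegativity is asked only from [a] on: the functions [lap k j] below can be negative left of
    0. *)
Lemma integral_halfline_FTC f F (a : R) :
  (forall x, a <= x -> 0 <= f x) -> continuous f ->
  (forall x, is_derive x 1 F (- f x)) -> F x @[x --> +oo] --> 0 ->
  (\int[mu]_(x in `[a, +oo[) (f x)%:E = (F a)%:E)%E.
Proof.
move=> f0 cf dF F0.
have dNF x : is_derive x 1 (- F) (f x).
  by rewrite -[f x]opprK; apply: is_deriveN.
rewrite (@ge0_continuous_FTC2y _ f (- F) a 0)//.
- by rewrite -EFinB /= sub0r opprK.
- exact: continuous_subspaceT.
- by rewrite -[X in _ --> X]oppr0; exact: cvgN.
- apply: cvg_at_right_filter.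
  exact: (is_derive1_continuous dNF).
- by move=> x _; rewrite derive1E derive_val.
Qed.

Lemma integralT_FTC f F (l : R) :
  (forall x, 0 <= f x) -> continuous f ->
  (forall x, is_derive x 1 F (f x)) ->
  F x @[x --> -oo] --> 0 -> F x @[x --> +oo] --> l ->
  (\int[mu]_x (f x)%:E = l%:E)%E.
Proof.
move=> f0 cf dF FNy Fy.
have mf : measurable_fun [set: R] f by exact: continuous_measurable_fun.
(* Split at 0 and reflect the negative half, so that both pieces are integrals up to +oo. *)
rewrite -(setUv `[0%R, +oo[) ge0_integral_setU//=; last 4 first.
- exact: measurableC.
- by apply/measurable_EFinP; rewrite setUv.
- by move=> x _; rewrite lee_fin.
- exact/disj_setPCl.
rewrite setCitvr integral_itv_bndo_bndc; last first.
  exact/measurable_EFinP/measurable_funTS.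
rewrite -{2}oppr0 ge0_integration_by_substitutionNy//; last first.
  exact: continuous_subspaceT.
rewrite (@ge0_continuous_FTC2y _ f F 0 l)//; last 3 first.
- exact: continuous_subspaceT.
- apply: cvg_at_right_filter.
  exact: (is_derive1_continuous dF).
- by move=> x _; rewrite derive1E derive_val.
have dFN x : is_derive x 1 (F \o -%R) (- (f \o -%R) x).
  have := @is_derive1_subl _ F 0 x (f (- x)).
  rewrite !sub0r => /(_ (dF _)); congr is_derive.
  by apply/funext => y; rewrite sub0r.
have cfN : continuous (f \o -%R).
  by move=> x; apply: continuous_comp; [exact: opp_continuous|exact: cf].
rewrite (integral_halfline_FTC _ cfN dFN)//.
  by rewrite /= oppr0 -EFinB -EFinD subrK.
  by move=> x _; exact: f0.
exact/cvgNy_compNP.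
Qed.

Lemma integralT_shift f (a : R) : (forall x, 0 <= f x) -> continuous f ->
  (\int[mu]_x (f x)%:E = \int[mu]_x (f (x + a))%:E)%E.
Proof.
move=> f0 cf.
have d1 x : is_derive x 1 (shift a) (1:R) by exact: is_derive_shift.
have dE : derive1 (shift a : R -> R) = cst 1.
  by apply/funext => x; rewrite derive1E derive_val.
rewrite (@increasing_ge0_integration_by_substitutionT _ (shift a))//.
- by apply: eq_integral => x _; rewrite dE /= !fctE mulr1.
- by move=> x y; rewrite /= ltrD2r.
- by rewrite dE => x; exact: cst_continuous.
- by rewrite dE; exact: is_cvg_cst.
- by rewrite dE; exact: is_cvg_cst.
- apply/cvgrNyPle => A; near=> x; rewrite /= -lerBrDr; near: x.
  exact: nbhs_ninfty_le (num_real _).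
- apply/cvgryPge => A; near=> x; rewrite /= -lerBlDr; near: x.
  exact: nbhs_pinfty_ge (num_real _).
Unshelve. all: by end_near. Qed.

Lemma tonelli_halfline (g : R * R -> \bar R) (a : R) :
  measurable_fun setT g -> (forall z, 0 <= g z)%E ->
  (\int[mu]_x \int[mu]_(y in `[a, +oo[) g (x, y) =
   \int[mu]_(y in `[a, +oo[) \int[mu]_x g (x, y))%E.
Proof.
move=> mg g0.
(* Extending [g] by zero turns the half-plane into the whole plane, where Tonelli applies. *)
pose h := (g \_ (setT `*` `[a, +oo[%classic)).
have hE x y : h (x, y) = ((fun y => g (x, y)) \_ `[a, +oo[) y.
  rewrite /h !patchE; congr (if _ then _ else _).
  by apply/idP/idP; rewrite !inE/=; [case|split].
transitivity (\int[mu]_x \int[mu]_y h (x, y))%E.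
  apply: eq_integral => x _; rewrite integral_mkcond.
  by apply: eq_integral => y _; rewrite hE.
rewrite fubini_tonelli.
- rewrite [RHS]integral_mkcond; apply: eq_integral => y _.
  under eq_integral do rewrite hE.
  rewrite patchE; case: ifPn => ya.
    by apply: eq_integral => x _; rewrite patchE ya.
  by rewrite integral0_eq// => x _; rewrite patchE (negbTE ya).
- apply/(measurable_restrictT _ _).1 => //; first exact: measurableX.
  exact: measurable_funTS.
- by move=> z; rewrite /h patchE; case: ifP.
Qed.

End integrals.

(** * The correlation of theta / rho with 1 / rho *)

Section kernel.
Context {R : realType}.
Implicit Types (s v x : R).
Notation mu := (@lebesgue_measure R).

(** Minus the derivative of [1 / rho]: a translate of [1 / rho] is thus a tail integral of
    translates of [kappa]. *)
Definition kappa s : R := expR s ^+ 2 / rho s ^+ 3.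

Lemma kappa_ge0 s : 0 <= kappa s.
Proof. by rewrite divr_ge0 ?exprn_ge0 ?expR_ge0// ltW// rho_gt0. Qed.

Lemma is_derive_rhoV s : is_derive s 1 (fun y => (rho y)^-1) (- kappa s).
Proof.
apply: (is_derive1V (rho_neq0 s) (is_derive_rho s)).
by rewrite /kappa; field; exact: rho_neq0.
Qed.

Lemma continuous_rhoV : continuous (fun s => (rho s)^-1).
Proof. exact: is_derive1_continuous is_derive_rhoV. Qed.

Lemma continuous_kappa : continuous kappa.
Proof.
move=> s; apply: cvgM.
  apply: (@continuous_comp _ _ _ expR (fun x => x ^+ 2)).
    exact: continuous_expR.
  exact: exprn_continuous.
apply: cvgV; first by rewrite expf_eq0 /= rho_neq0.
apply: (@continuous_comp _ _ _ rho (fun x => x ^+ 3)).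
  exact: continuous_rho.
exact: exprn_continuous.
Qed.

Lemma continuous_addl (f : R -> R) s :
  continuous f -> continuous (fun v => f (s + v)).
Proof.
move=> cf x; apply: continuous_comp; last exact: cf.
by apply: cvgD; [exact: cvg_cst|exact: cvg_id].
Qed.

Lemma continuous_addr (f : R -> R) s :
  continuous f -> continuous (fun v => f (v + s)).
Proof.
move=> cf x; apply: continuous_comp; last exact: cf.
by apply: cvgD; [exact: cvg_id|exact: cvg_cst].
Qed.

Lemma continuous_subl (f : R -> R) s :
  continuous f -> continuous (fun v => f (s - v)).
Proof.
move=> cf x; apply: continuous_comp; last exact: cf.
by apply: cvgB; [exact: cvg_cst|exact: cvg_id].
Qed.

Lemma cvg_rhoVy : (rho x)^-1 @[x --> +oo] --> (0 : R).
Proof.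
apply: (@squeeze_cvgr _ _ _ _ (cst 0) (fun x => expR (- x))).
- apply: nearW => x; rewrite invr_ge0 ltW ?rho_gt0//= expRN.
  by rewrite lef_pV2 ?posrE ?expR_gt0 ?rho_gt0// ltW// expR_lt_rho.
- exact: cvg_cst.
- exact: cvgr_expR.
Qed.

Lemma cvgy_addl (f : R -> R) s (l : R) : f x @[x --> +oo] --> l ->
  f (s + x) @[x --> +oo] --> l.
Proof.
move=> fl; apply: (@cvg_comp _ _ _ (fun x => s + x) f _ _ _ _ fl).
apply/cvgryPge => A; near=> x; rewrite /= -lerBlDl; near: x.
exact: nbhs_pinfty_ge (num_real _).
Unshelve. all: by end_near. Qed.

Lemma cvgy_subl (f : R -> R) s (l : R) : f x @[x --> -oo] --> l ->
  f (s - x) @[x --> +oo] --> l.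
Proof.
move=> fl; apply: (@cvg_comp _ _ _ (fun x => s - x) f _ _ _ _ fl).
apply/cvgrNyPle => A; near=> x; rewrite /= lerBlDl -lerBlDr; near: x.
exact: nbhs_pinfty_ge (num_real _).
Unshelve. all: by end_near. Qed.

Lemma integral_kappa s x :
  (\int[mu]_(v in `[x, +oo[) (kappa (s + v))%:E = ((rho (s + x))^-1)%:E)%E.
Proof.
have d v : is_derive v 1 (fun y => (rho (s + y))^-1) (- kappa (s + v)).
  exact: is_derive1_addl (is_derive_rhoV _).
apply: (integral_halfline_FTC _ _ d).
- by move=> v _; exact: kappa_ge0.
- exact/continuous_addl/continuous_kappa.
- exact/(@cvgy_addl (fun x => (rho x)^-1))/cvg_rhoVy.
Qed.

(* Obtained by integrating by parts, [rho s / rho (s + v)] being a primitive of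
   [(1 - e^(2 v)) e^(2 s) / (rho s * rho (s + v) ^ 3)]. *)
Definition antider v s : R :=
  expR v / (expR v ^+ 2 - 1) *
  (theta (s + v) - expR v * (theta s * (rho s / rho (s + v)))).

Lemma expR_sqrB1_gt0 v : 0 < v -> 0 < expR v ^+ 2 - 1.
Proof.
by move=> v0; rewrite subr_gt0 expr_gt1 ?expR_ge0// -expR0 ltr_expR.
Qed.

Lemma is_derive_antider v s : 0 < v ->
  is_derive s 1 (antider v) (theta s / rho s * kappa (s + v)).
Proof.
move=> v0; have c0 := expR_sqrB1_gt0 v0.
have d1 := is_derive1_addr (is_derive_theta (s + v)).
have d2 := is_derive1_addr (is_derive_rhoV (s + v)).
have d3 := is_derive1M (is_derive_rho s) d2 erefl.
have d4 := is_derive1M (is_derive_theta s) d3 erefl.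
have d5 := is_derive1M (is_derive_cst (- expR v : R^o) s 1) d4 erefl.
have d6 := is_derive1D d1 d5 erefl.
have d7 := is_derive1M
  (is_derive_cst (expR v / (expR v ^+ 2 - 1) : R^o) s 1) d6 erefl.
(* Constants become values of [cst], to match the function differentiated in [d7]. *)
have -> : antider v = (fun y => cst (expR v / (expR v ^+ 2 - 1)) y *
    (theta (y + v) + cst (- expR v) y * (theta y * (rho y / rho (y + v))))).
  by apply/funext => y; rewrite /antider /cst mulNr.
apply: (is_derive_eq d7).
rewrite /cst /kappa !mulr0 !addr0.
have := rho_sqr s; have := rho_sqr (s + v).
rewrite expRD => e1 e2.
have c1 : expR v ^+ 2 - 1 != 0 by rewrite gt_eqF.
have r1 := rho_neq0 s; have r2 := rho_neq0 (s + v).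
apply/eqP; rewrite -subr_eq0; apply/eqP.
(* The discrepancy is a multiple of a combination of the relations [rho_sqr] at [s] and at
   [s + v]. *)
transitivity (- (expR v ^+ 2 * theta s * expR s ^+ 2 /
    ((expR v ^+ 2 - 1) * rho s * rho (s + v) ^+ 3)) *
  (rho (s + v) ^+ 2 - expR v ^+ 2 * rho s ^+ 2 + expR v ^+ 2 - 1)).
  by field; rewrite r1 r2 c1.
by rewrite e1 e2; ring.
Qed.

Lemma rho_ratio_le1 v s : 0 <= v -> rho s / rho (s + v) <= 1.
Proof.
move=> v0; rewrite ler_pdivrMr ?rho_gt0// mul1r ler_sqrt; last first.
  by rewrite addr_ge0// sqr_ge0.
by rewrite lerD2l ler_pXn2r ?nnegrE ?expR_ge0// ler_expR lerDl.
Qed.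

Lemma cvg_antiderNy v : 0 < v -> antider v x @[x --> -oo] --> (0 : R).
Proof.
move=> v0; rewrite -(mulr0 (expR v / (expR v ^+ 2 - 1))); apply: cvgMr.
have c0 := expR_gt0 v.
(* Each term is O(e^x), by [theta_le] and because the ratio of the two values of [rho] is at most
   1. *)
apply: (@squeeze_cvgr _ _ _ _ (fun x => - (2 * expR v) * expR x)
    (fun x => 2 * expR v * expR x)).
- apply: nearW => x; have := theta_ge0 x; have := theta_le x.
  have := theta_ge0 (x + v); have := theta_le (x + v); rewrite expRD.
  have := rho_ratio_le1 x (ltW v0).
  have : 0 <= rho x / rho (x + v) by rewrite divr_ge0 ?(ltW (rho_gt0 _)).
  set q := rho x / _ => *.
  have q1 : theta x * q <= 2 * expR x.
    by rewrite (@le_trans _ _ (theta x))// ler_piMr.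
  have q0 : 0 <= theta x * q by rewrite mulr_ge0.
  by apply/andP; split; nra.
- rewrite -[X in _ --> X](mulr0 (- (2 * expR v))).
  by apply: cvgMr; exact: cvg_expRNy.
- rewrite -[X in _ --> X](mulr0 (2 * expR v)).
  by apply: cvgMr; exact: cvg_expRNy.
Qed.

(** Here [theta (x + v) - theta x] tends to [v], and the factor [expR v * rho x / rho (x + v)]
    differs from 1 by O(e^(-2 x)), which outweighs the growth of [theta x]. *)
Lemma cvg_antidery v : 0 < v ->
  antider v x @[x --> +oo] --> v * expR v / (expR v ^+ 2 - 1).
Proof.
move=> v0; rewrite -mulrA mulrC; apply: cvgMr.
have c0 := expR_gt0 v.
(* The constant 3 is 1 from the upper bound on [theta x] in [theta_bounds], plus 2 from
   [theta x * d <= 2 * expR (- x)]. *)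
apply: (@squeeze_cvgr _ _ _ _ (fun x => v - 3 * expR (- x))
    (fun x => v + expR (- x))).
- apply: nearW => x; have := theta_ge0 x; have := theta_le x.
  have := theta_bounds x; have := theta_bounds (x + v).
  have e0 := expR_gt0 x; have f0 := expR_gt0 (- x).
  have ef : expR (- x) * expR x = 1 by rewrite expRN mulVf// gt_eqF.
  have cv : expR (- (x + v)) <= expR (- x) by rewrite ler_expR; lra.
  have c1 : 1 < expR v by rewrite -expR0 ltr_expR.
  have r0 := rho_gt0 x; have q0 := rho_gt0 (x + v).
  have := rho_sqr x; have := rho_sqr (x + v); rewrite expRD => Eq Er.
  set d := expR v * (rho x / rho (x + v)) - 1.
  (* Multiplying by the conjugate removes the cancellation: the sign and the size of [d] can then be
     read off. *)
  have dE : d = (expR v ^+ 2 - 1) /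
      (rho (x + v) * (expR v * rho x + rho (x + v))).
    apply/eqP; rewrite -subr_eq0; apply/eqP.
    transitivity
      ((expR v ^+ 2 * rho x ^+ 2 - rho (x + v) ^+ 2 - (expR v ^+ 2 - 1)) /
      (rho (x + v) * (expR v * rho x + rho (x + v)))).
      rewrite /d; field; rewrite !gt_eqF// addr_gt0// mulr_gt0//.
    by rewrite Eq Er [X in X / _](_ : _ = 0) ?mul0r//; ring.
  have d0 : 0 <= d.
    rewrite dE divr_ge0 ?(ltW (expR_sqrB1_gt0 v0))//.
    by rewrite mulr_ge0 ?addr_ge0 ?mulr_ge0 ?(ltW r0) ?(ltW q0) ?(ltW c0).
  have d1 : d <= expR (- x) ^+ 2.
    rewrite dE ler_pdivrMr; last by rewrite mulr_gt0 ?addr_gt0 ?mulr_gt0.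
    have h1 : 1 <= expR (- x) ^+ 2 * rho x ^+ 2.
      rewrite Er mulrDr -exprMn ef expr1n mulr1 lerDr sqr_ge0 //.
    have h2 : expR v ^+ 2 <= expR (- x) ^+ 2 * rho (x + v) ^+ 2.
      by rewrite Eq mulrDr -exprMn mulrA ef mul1r lerDr mulr1 sqr_ge0.
    have h3 : 0 <= expR (- x) ^+ 2 * (rho (x + v) * (expR v * rho x)).
      by rewrite !mulr_ge0// ?sqr_ge0 ?(ltW r0) ?(ltW q0) ?(ltW c0).
    by rewrite [rho (x + v) * _]mulrDr -expr2 mulrDr; lra.
  have -> : expR v * (theta x * (rho x / rho (x + v))) = theta x * (1 + d).
    by rewrite /d; ring.
  move=> /andP[b1 b2] /andP[b3 b4] b5 b6.
  have tf : theta x * d <= 2 * expR (- x).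
    apply: (@le_trans _ _ (2 * expR x * expR (- x) ^+ 2)).
      by apply: ler_pM.
    by rewrite -mulrA [expR x * _]mulrC expr2 -mulrA ef mulr1.
  have td : 0 <= theta x * d by rewrite mulr_ge0.
  by apply/andP; split; rewrite mulrDr mulr1; lra.
- rewrite -[X in _ --> X]subr0 -[X in _ - X](mulr0 3).
  by apply: cvgB; [exact: cvg_cst|apply: cvgMr; exact: cvgr_expR].
- rewrite -[X in _ --> X]addr0.
  by apply: cvgD; [exact: cvg_cst|exact: cvgr_expR].
Qed.

Lemma integral_theta_kappa v : 0 < v ->
  (\int[mu]_s (theta s / rho s * kappa (s + v))%:E =
   (v * expR v / (expR v ^+ 2 - 1))%:E)%E.
Proof.
move=> v0; apply: (integralT_FTC _ _ (fun s => is_derive_antider s v0)).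
- by move=> s; rewrite mulr_ge0 ?kappa_ge0// divr_ge0 ?theta_ge0// ltW// rho_gt0.
- move=> s; apply: cvgM; last exact/continuous_addr/continuous_kappa.
  by apply: cvgM; [exact: continuous_theta|exact: continuous_rhoV].
- exact: cvg_antiderNy.
- exact: cvg_antidery.
Qed.

End kernel.

(** * Iterated tail integrals of the exponential series *)

Section laplace.
Context {R : realType}.
Implicit Types (s v x : R).
Notation mu := (@lebesgue_measure R).
Notation b j := ((j.*2.+1)%:R : R).

Lemma nneseries_EFin (u : nat -> R) (l : R) : series u @ \oo --> l ->
  (\sum_(j <oo) (u j)%:E = l%:E)%E.
Proof.
move=> ul; apply: cvg_lim => //.
rewrite [X in X @ _](_ : _ = EFin \o series u); last first.
  by apply/funext => n; rewrite /= sumEFin.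
by apply: cvg_EFin; [exact: nearW|exact: ul].
Qed.

Lemma nneseries_geometric (a z : R) : 0 <= z < 1 ->
  (\sum_(j <oo) (a * z ^+ j)%:E = (a / (1 - z))%:E)%E.
Proof.
move=> /andP[z0 z1]; apply: nneseries_EFin.
by apply: cvg_geometric_series; rewrite ger0_norm.
Qed.

(* The [k]-fold iterated tail integral of [x e^(- (2 j + 1) x)]. *)
Definition lap k j x : R :=
  expR (- (b j * x)) * (x / b j ^+ k + k%:R / b j ^+ k.+1).

Lemma od_gt0 j : 0 < b j. Proof. by rewrite ltr0n. Qed.
Lemma od_neq0 j : b j != 0. Proof. by rewrite pnatr_eq0. Qed.
Lemma od_ge1 j : 1 <= b j. Proof. by rewrite ler1n. Qed.

Lemma lap_ge0 k j x : 0 <= x -> 0 <= lap k j x.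
Proof.
move=> x0; rewrite mulr_ge0 ?expR_ge0// addr_ge0// divr_ge0//.
Qed.

Lemma is_derive_lap k j x : is_derive x 1 (lap k.+1 j) (- lap k j x).
Proof.
have d1 : is_derive x 1 (fun y => - b j * y) (- b j).
  have := is_derive1M (is_derive_cst (- b j : R^o) x 1) (is_derive_id x 1) erefl.
  by rewrite /= mulr0 addr0 mulr1.
have d2 := is_derive1_comp_eq d1 (is_derive_expR _) erefl.
have d3 := is_derive1M (is_derive_id x 1)
  (is_derive_cst ((b j ^+ k.+1)^-1 : R^o) x 1) erefl.
have d4 := is_derive1D d3
  (is_derive_cst (k.+1%:R / b j ^+ k.+2 : R^o) x 1) erefl.
have d5 := is_derive1M d2 d4 erefl.
have -> : lap k.+1 j = (fun y => expR (- b j * y) *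
    (id y * cst (b j ^+ k.+1)^-1 y + cst (k.+1%:R / b j ^+ k.+2) y)).
  by apply/funext => y; rewrite /lap mulNr.
apply: (is_derive_eq d5).
rewrite /= /lap mulr0 add0r addr0 !mulNr -[k.+1%:R]natr1 !exprS.
by move: (od_neq0 j); move: (b j) => B B0; field; rewrite expf_neq0 ?B0.
Qed.

Lemma continuous_lap k j : continuous (lap k j).
Proof.
move=> x; apply: cvgM.
  apply: (@continuous_comp _ _ _ (fun x => - (b j * x)) expR); last first.
    exact: continuous_expR.
  by apply: cvgN; apply: cvgMr; exact: cvg_id.
apply: cvgD; last exact: cvg_cst.
by apply: cvgMl; exact: cvg_id.
Qed.

(** As [b j >= 1], the exponential is at most the square of [expR (- (x / 2))]; one factor absorbs
    [x], the other provides the decay. *)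
Lemma lap_le k j x : 0 <= x -> lap k j x <= (2 + k%:R) * expR (- (x / 2)).
Proof.
move=> x0; have b1 := od_ge1 j.
have h1 : x / b j ^+ k + k%:R / b j ^+ k.+1 <= x + k%:R.
  by apply: lerD; rewrite ler_pdivrMr ?exprn_gt0 ?od_gt0// ler_peMr// exprn_ege1.
have e1 : expR (- (b j * x)) <= expR (- (x / 2)) * expR (- (x / 2)).
  by rewrite -expRD ler_expR; nra.
have e0 := expR_gt0 (- (x / 2)).
have e2 : expR (- (x / 2)) <= 1 by rewrite -[leRHS]expR0 ler_expR; lra.
have e3 : x * expR (- (x / 2)) <= 2.
  rewrite expRN ler_pdivrMr ?expR_gt0//.
  have := expR_ge1Dx (x / 2); lra.
apply: (@le_trans _ _ (expR (- (x / 2)) * expR (- (x / 2)) * (x + k%:R))).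
  apply: ler_pM => //; rewrite ?expR_ge0// addr_ge0// divr_ge0//.
rewrite mulrC mulrA ler_pM2r//.
have k0 : 0 <= k%:R :> R by [].
nra.
Qed.

Lemma cvg_lapy k j : lap k j x @[x --> +oo] --> (0 : R).
Proof.
apply: (@squeeze_cvgr _ _ _ _ (cst 0) (fun x => (2 + k%:R) * expR (- (x / 2)))).
- near=> x; have x0 : 0 <= x by near: x; exact: nbhs_pinfty_ge (num_real _).
  by rewrite lap_ge0//= lap_le.
- exact: cvg_cst.
- rewrite -[X in _ --> X](mulr0 (2 + k%:R)); apply: cvgMr.
  apply: (@cvg_comp _ _ _ (fun x => x / 2) (fun x : R => expR (- x))
    _ +oo _ _ (@cvgr_expR R)).
  apply/cvgryPge => A; near=> x; rewrite ler_pdivlMr//; near: x.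
Unshelve. all: by end_near. Qed.

Lemma integral_lap k j x : 0 <= x ->
  (\int[mu]_(v in `[x, +oo[) (lap k j v)%:E = (lap k.+1 j x)%:E)%E.
Proof.
move=> x0; apply: (integral_halfline_FTC _ _ (is_derive_lap k j)).
- by move=> v xv; apply: lap_ge0; exact: le_trans xv.
- exact: continuous_lap.
- exact: cvg_lapy.
Qed.

Lemma integral_nneseries_lap k x : 0 <= x ->
  (\int[mu]_(v in `[x, +oo[) \sum_(j <oo) (lap k j v)%:E =
   \sum_(j <oo) (lap k.+1 j x)%:E)%E.
Proof.
move=> x0; rewrite integral_nneseries//.
- by apply: eq_eseriesr => j _; exact: integral_lap.
- move=> j; apply/measurable_EFinP/measurable_funTS.
  by apply: continuous_measurable_fun; exact: continuous_lap.
- move=> j v; rewrite /= in_itv/= andbT => xv; rewrite lee_fin.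
  by apply: lap_ge0; exact: le_trans xv.
Qed.

(** A geometric series of ratio [e^(-2 v)], which is below 1 as [v] is positive. *)
Lemma nneseries_lap0 v : 0 < v ->
  (\sum_(j <oo) (lap 0 j v)%:E = (v * expR v / (expR v ^+ 2 - 1))%:E)%E.
Proof.
move=> v0; have c0 := expR_sqrB1_gt0 v0; have e0 := expR_gt0 v.
transitivity (\sum_(j <oo) (v * (expR v)^-1 * ((expR v ^+ 2)^-1) ^+ j)%:E)%E.
  apply: eq_eseriesr => j _; congr EFin.
  rewrite /lap mul0r addr0 expr0 divr1 mulrC -mulrA; congr *%R.
  by rewrite expRN expRM_natl -!exprVn -exprM -exprS mul2n.
rewrite nneseries_geometric.
  congr EFin; field; rewrite !gt_eqF//.
by rewrite invr_ge0 sqr_ge0 invf_lt1 ?exprn_gt0// -subr_gt0.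
Qed.

(** Shifting by [x] moves the parameter onto [1 / rho (s + x)], a tail integral of [kappa]. After
    Tonelli the inner integral is [integral_theta_kappa], expanded by [nneseries_lap0]. *)
Lemma integral_theta_rho x : 0 <= x ->
  (\int[mu]_s (theta (s - x) / rho (s - x) / rho s)%:E =
   \sum_(j <oo) (lap 1 j x)%:E)%E.
Proof.
move=> x0.
have tr0 s : 0 <= theta s / rho s by rewrite divr_ge0 ?theta_ge0// ltW// rho_gt0.
have ctr : continuous (fun s => theta s / rho s).
  by move=> s; apply: cvgM; [exact: continuous_theta|exact: continuous_rhoV].
rewrite (@integralT_shift _ (fun s => theta (s - x) / rho (s - x) / rho s) x).
- under eq_integral do rewrite addrK.
  transitivity (\int[mu]_s \int[mu]_(v in `[x, +oo[)
      ((theta s / rho s * kappa (s + v))%:E))%E.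
    apply: eq_integral => s _; under eq_integral do rewrite EFinM.
    rewrite ge0_integralZl_EFin//.
    + by rewrite integral_kappa -EFinM.
    + by move=> v _; rewrite lee_fin kappa_ge0.
    + apply/measurable_EFinP/measurable_funTS; apply: continuous_measurable_fun.
      exact/continuous_addl/continuous_kappa.
  have mg : measurable_fun setT
      (fun z : R * R => (theta z.1 / rho z.1 * kappa (z.1 + z.2))%:E).
    apply/measurable_EFinP/measurable_funM.
      apply: (@measurableT_comp _ _ _ _ _ _ (fun s => theta s / rho s)) => //.
      exact: continuous_measurable_fun.
    apply: measurableT_comp; last exact: measurable_funD.
    by apply: continuous_measurable_fun; exact: continuous_kappa.
  have g0 (z : R * R) : (0 <= (theta z.1 / rho z.1 * kappa (z.1 + z.2))%:E)%E.
    by rewrite lee_fin mulr_ge0// kappa_ge0.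
  rewrite (tonelli_halfline _ mg g0).
  rewrite -integral_nneseries_lap//.
  (* Both half-lines are opened at [x], since the inner integral is evaluated only for [0 < v] while
     [x] may be 0. *)
  rewrite -integral_itv_obnd_cbnd; last first.
    apply: measurable_funTS.
    exact: (@measurable_fun_fubini_tonelli_G _ _ _ _ _ mu _ mg g0).
  rewrite -[RHS]integral_itv_obnd_cbnd; last first.
    apply: (@ge0_emeasurable_sum _ _ _ _ (fun j v => (lap 0 j v)%:E) xpredT).
      move=> j v; rewrite /= in_itv/= andbT => xv _; rewrite lee_fin.
      by apply: lap_ge0; exact/ltW/(le_lt_trans x0).
    move=> j _; apply/measurable_EFinP/measurable_funTS.
    by apply: continuous_measurable_fun; exact: continuous_lap.
  apply: eq_integral => v; rewrite inE/= in_itv/= andbT => xv.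
  have v0 : 0 < v by exact: le_lt_trans xv.
  by rewrite integral_theta_kappa// nneseries_lap0.
- by move=> s; rewrite divr_ge0// ltW// rho_gt0.
- move=> s; apply: cvgM; last exact: continuous_rhoV.
  exact: (@continuous_addr _ (fun s => theta s / rho s) (- x)).
Qed.

End laplace.

(** * Power series in tau *)

Section coefficients.
Context {R : realType}.
Implicit Types (s v x : R) (c : nat -> R).
Notation mu := (@lebesgue_measure R).
Notation b j := ((j.*2.+1)%:R : R).

(** The coefficients of [sum_j c_j t^(2 j + 1)] multiplied by [(1 + t^2) / (1 - t^2)]. *)
Definition halfsum c j : R := c j + 2 * \sum_(i < j) c i.

(** The matrix of [halfsum]. For [i <= j] it is twice the interpolation weight at 1/2; its vanishing
    for [j < i] encodes the ordering of the summation indices. *)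
Definition half_weight i j : R := (i == j)%:R + 2 * (i < j)%:R.

Lemma half_weight_ge0 i j : 0 <= half_weight i j.
Proof. by rewrite addr_ge0// mulr_ge0. Qed.

Lemma half_weightE i j : (i <= j)%N -> (2^-1 ^+ (i == j)) = half_weight i j / 2.
Proof.
rewrite /half_weight leq_eqVlt => /orP[/eqP ->|ij].
  by rewrite eqxx ltnn /= expr1 mulr0 addr0 mul1r.
by rewrite ij (ltn_eqF ij) /= expr0 add0r mulr1 divff.
Qed.

Lemma half_weight0 i j : (j < i)%N -> half_weight i j = 0.
Proof.
by move=> ji; rewrite /half_weight (gtn_eqF ji) ltnNge ltnW// mulr0 addr0.
Qed.

Lemma sum_half_weight c j :
  \sum_(0 <= i < j.+1) c i * half_weight i j = halfsum c j.
Proof.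
rewrite /halfsum mulr_sumr /half_weight.
rewrite big_nat_recr//= eqxx ltnn mulr0 addr0 mulr1 addrC; congr +%R.
rewrite big_mkord; apply: eq_bigr => i _.
by rewrite (ltn_eqF (ltn_ord i)) ltn_ord add0r mulr1 mulrC.
Qed.

Lemma nneseries_half_weight c (w : \bar R) j : (forall i, 0 <= c i) ->
  (0 <= w)%E ->
  (\sum_(i <oo) ((c i * half_weight i j)%:E * w) = (halfsum c j)%:E * w)%E.
Proof.
move=> c0 w0.
have t0 i : (0 <= (c i * half_weight i j)%:E)%E.
  by rewrite lee_fin mulr_ge0// half_weight_ge0.
rewrite (@nneseries_split _ _ 0%N j.+1); last by move=> i _; rewrite mule_ge0.
rewrite add0n [X in (_ + X)%E]eseries0 ?adde0; last first.
  by move=> i ji _; rewrite half_weight0// mulr0 mul0e.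
by rewrite -ge0_sume_distrl// sumEFin sum_half_weight.
Qed.

(** Extended real values let sums and integrals of nonnegative terms be exchanged with no
    convergence to check. *)
Definition tau_series c s : \bar R :=
  (\sum_(j <oo) (c j * tau s ^+ j.*2.+1)%:E)%E.

Lemma tau_ge0 s : 0 <= tau s. Proof. exact/ltW/tau_gt0. Qed.

Lemma tau_series_ge0 c s : (forall j, 0 <= c j) -> (0 <= tau_series c s)%E.
Proof.
move=> c0; apply: nneseries_ge0 => j _ _.
by rewrite lee_fin mulr_ge0// exprn_ge0// tau_ge0.
Qed.

Lemma tauX_rho_ge0 j s : 0 <= tau s ^+ j.*2.+1 / rho s.
Proof. by rewrite divr_ge0 ?exprn_ge0 ?tau_ge0// ltW// rho_gt0. Qed.

Lemma halfsum_ge0 c j : (forall j, 0 <= c j) -> 0 <= halfsum c j.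
Proof. by move=> c0; rewrite addr_ge0// mulr_ge0// sumr_ge0. Qed.

Lemma rhoV_tau s : (rho s)^-1 = (1 - tau s ^+ 2) / (1 + tau s ^+ 2).
Proof. by rewrite rho_tau invf_div. Qed.

(* This is [rho = (1 + tau^2) / (1 - tau^2) = 1 + 2 tau^2 + 2 tau^4 + ...]. *)
Lemma tau_expansion i s :
  (\sum_(j <oo) (half_weight i j * (tau s ^+ j.*2.+1 / rho s))%:E =
   (tau s ^+ i.*2.+1)%:E)%E.
Proof.
have t0 := tau_gt0 s; have t1 := tau_sqr_lt1 s; have r0 := rho_gt0 s.
have f0 j : 0 <= half_weight i j * (tau s ^+ j.*2.+1 / rho s).
  by apply: mulr_ge0; [exact: half_weight_ge0|exact: tauX_rho_ge0].
rewrite (@nneseries_split _ _ 0%N i.+1); last by move=> j _; rewrite lee_fin.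
rewrite add0n -nneseries_addn; last by move=> j; rewrite lee_fin.
rewrite big_nat_recr//= big_nat big1 ?add0e; last first.
  by move=> j /andP[_ ji]; rewrite half_weight0// mul0r.
rewrite {1}/half_weight eqxx ltnn mulr0 addr0 mul1r.
under eq_eseriesr.
  move=> j _.
  rewrite (_ : _ * _ = 2 * tau s ^+ i.*2.+1 * tau s ^+ 2 / rho s *
      (tau s ^+ 2) ^+ j); last first.
    have ij : (i < (j + i).+1)%N by rewrite ltnS leq_addl.
    rewrite /half_weight addnS ij (ltn_eqF ij) add0r mulr1.
    rewrite (_ : (j + i).+1.*2.+1 = i.*2.+1 + 2 + 2 * j)%N; last by lia.
    by rewrite exprD exprM exprD; ring.
  over.
rewrite nneseries_geometric ?sqr_ge0// -EFinD; congr EFin.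
rewrite rhoV_tau; field.
by rewrite !gt_eqF// ?subr_gt0// addr_gt0// exprn_gt0.
Qed.

(** Each power of [tau s] is expanded by [tau_expansion] and the sums are exchanged. The result can
    be integrated termwise, [tau^(2 j + 1) / rho] being the derivative of
    [tau^(2 j + 1) / (2 j + 1)]. *)
Lemma tau_series_halfsum c s : (forall j, 0 <= c j) ->
  (tau_series c s =
   \sum_(j <oo) (halfsum c j * (tau s ^+ j.*2.+1 / rho s))%:E)%E.
Proof.
move=> c0.
have q0 i j : 0 <= half_weight i j * (tau s ^+ j.*2.+1 / rho s).
  by apply: mulr_ge0; [exact: half_weight_ge0|exact: tauX_rho_ge0].
transitivity (\sum_(i <oo) \sum_(j <oo)
  (c i * (half_weight i j * (tau s ^+ j.*2.+1 / rho s)))%:E)%E.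
  apply: eq_eseriesr => i _; rewrite EFinM -tau_expansion -nneseriesZl//.
  by move=> j _; rewrite lee_fin.
rewrite nneseries_interchange; last first.
  by move=> i j; rewrite lee_fin mulr_ge0.
apply: eq_eseriesr => j _.
rewrite [RHS]EFinM -nneseries_half_weight ?lee_fin ?tauX_rho_ge0//.
by apply: eq_eseriesr => i _; rewrite -EFinM mulrA.
Qed.

Lemma is_derive_tauX j s :
  is_derive s 1 (fun y => tau y ^+ j.*2.+1 / b j) (tau s ^+ j.*2.+1 / rho s).
Proof.
have d := is_derive1M (is_derive1X (n := j.*2.+1) (is_derive_tau s) erefl)
  (is_derive_cst ((b j)^-1 : R^o) s 1) erefl.
apply: (is_derive_eq d); rewrite /= mulr0 add0r exprS.
by move: (od_neq0 (R := R) j); move: (b j) => B B0; field; rewrite B0 rho_neq0.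
Qed.

Lemma continuous_tauX_rho j : continuous (fun s => tau s ^+ j.*2.+1 / rho s).
Proof.
move=> s; apply: cvgM; last exact: continuous_rhoV.
apply: (@continuous_comp _ _ _ tau (fun x => x ^+ j.*2.+1)).
  exact: continuous_tau.
exact: exprn_continuous.
Qed.

Lemma cvg_tauXNy j : tau s ^+ j.*2.+1 / b j @[s --> -oo] --> (0 : R).
Proof.
rewrite -[X in _ --> X](mul0r (b j)^-1); apply: cvgMl.
rewrite -[X in _ --> X](expr0n R j.*2.+1).
apply: (@cvg_comp _ _ _ tau (fun x => x ^+ j.*2.+1) _ _ _ cvg_tauNy).
exact: exprn_continuous.
Qed.

Lemma integral_halfline_sub (f F : R -> R) s x :
  (forall y, 0 <= f y) -> continuous f ->
  (forall y : R, is_derive y 1 F (f y)) -> F y @[y --> -oo] --> (0 : R) ->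
  (\int[mu]_(v in `[x, +oo[) (f (s - v))%:E = (F (s - x))%:E)%E.
Proof.
move=> f0 cf dF F0.
have d v : is_derive v 1 (fun y => F (s - y)) (- f (s - v)).
  exact: is_derive1_subl (dF _).
apply: (integral_halfline_FTC _ _ d) => //.
- exact: continuous_subl.
- exact: cvgy_subl.
Qed.

Lemma integral_halfline_series (c : nat -> R) s x : (forall j, 0 <= c j) ->
  (\int[mu]_(v in `[x, +oo[) \sum_(j <oo)
     (c j * (tau (s - v) ^+ j.*2.+1 / rho (s - v)))%:E =
   tau_series (fun j => c j / b j)%R (s - x)%R)%E.
Proof.
move=> c0; rewrite integral_nneseries//.
- apply: eq_eseriesr => j _.
  under eq_integral do rewrite EFinM.
  rewrite ge0_integralZl_EFin//.
  + rewrite (integral_halfline_sub _ _ _ _ (is_derive_tauX j)) -?EFinM.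
    * by rewrite mulrA mulrAC.
    * exact: tauX_rho_ge0.
    * exact: continuous_tauX_rho.
    * exact: cvg_tauXNy.
  + by move=> v _; rewrite lee_fin tauX_rho_ge0.
  + apply/measurable_EFinP/measurable_funTS; apply: continuous_measurable_fun.
    apply: (@continuous_subl _ (fun s => tau s ^+ j.*2.+1 / rho s)).
  exact: continuous_tauX_rho.
- move=> j; apply/measurable_EFinP/measurable_funTS/measurable_funM => //.
  apply: continuous_measurable_fun.
  apply: (@continuous_subl _ (fun s => tau s ^+ j.*2.+1 / rho s)).
  exact: continuous_tauX_rho.
- by move=> j v _; rewrite lee_fin mulr_ge0// tauX_rho_ge0.
Qed.

Lemma integral_tau_series c s x : (forall j, 0 <= c j) ->
  (\int[mu]_(v in `[x, +oo[) tau_series c (s - v)%R =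
   tau_series (fun j => halfsum c j / b j)%R (s - x)%R)%E.
Proof.
move=> c0; under eq_integral do rewrite tau_series_halfsum//.
by apply: integral_halfline_series => j; exact: halfsum_ge0.
Qed.

(** This is [theta = 2 artanh tau], obtained by integrating [theta' = expR / rho] with
    [expR = 2 tau / (1 - tau^2)] expanded as a geometric series. *)
Lemma theta_series s : (theta s)%:E = tau_series (fun j => 2 / b j) s.
Proof.
transitivity (\int[mu]_(v in `[0%R, +oo[) (expR (s - v) / rho (s - v))%:E)%E.
  rewrite (integral_halfline_sub _ _ _ _ is_derive_theta) ?subr0//.
  - by move=> y; rewrite divr_ge0 ?expR_ge0// ltW// rho_gt0.
  - by move=> y; apply: cvgM; [exact: continuous_expR|exact: continuous_rhoV].
  - exact: cvg_thetaNy.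
rewrite -[in RHS](subr0 s) -integral_halfline_series//.
apply: eq_integral => v _; set y := s - v.
under eq_eseriesr.
  move=> j _.
  rewrite (_ : _ * _ = 2 * tau y / rho y * (tau y ^+ 2) ^+ j); last first.
    by rewrite exprS -mul2n exprM; ring.
  over.
rewrite nneseries_geometric ?sqr_ge0 ?tau_sqr_lt1//; congr EFin.
by rewrite expR_tau; ring.
Qed.

Lemma integral_theta_series s x :
  (\int[mu]_(v in `[x, +oo[) (theta (s - v) / rho (s - v))%:E =
   tau_series (fun j => 2 / b j ^+ 2)%R (s - x)%R)%E.
Proof.
have b0 j : 0 <= 2 / b j by rewrite divr_ge0.
rewrite [RHS](_ : _ = tau_series (fun j => 2 / b j / b j) (s - x)); last first.
  by congr tau_series; apply/funext => j; rewrite -mulrA -invfM.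
rewrite -integral_halfline_series//; apply: eq_integral => v _.
rewrite mulrC EFinM theta_series /tau_series -nneseriesZl; last first.
  by move=> j _; rewrite lee_fin mulr_ge0// exprn_ge0// tau_ge0.
by apply: eq_eseriesr => j _; rewrite -EFinM; congr EFin; ring.
Qed.

(** The coefficients of [Phi_m]. By [esum_chain_weight], [coef m j / 2 ^+ m.+1] is also the total
    weight of the chains of length [m + 1] ending in [j + 1]. *)
Fixpoint coef m j : R :=
  if m is m'.+1 then halfsum (coef m') j / b j else 2 / b j ^+ 2.

Lemma coef_ge0 m j : 0 <= coef m j.
Proof.
elim: m j => [|m IH] j /=; first by rewrite divr_ge0.
by rewrite divr_ge0// halfsum_ge0.
Qed.

Lemma measurable_tau_series c : (forall j, 0 <= c j) ->
  measurable_fun setT (tau_series c).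
Proof.
move=> c0.
apply: (@ge0_emeasurable_sum _ _ _ _
  (fun j s => (c j * tau s ^+ j.*2.+1)%:E) xpredT).
  by move=> j s _ _; rewrite lee_fin mulr_ge0// exprn_ge0// tau_ge0.
move=> j _; apply/measurable_EFinP/measurable_funM => //.
by apply: measurable_funX; apply: continuous_measurable_fun; exact: continuous_tau.
Qed.

(** Tonelli moves the tail integral from [G] outside the correlation with [1 / rho], where it raises
    the index of [lap]. An abstract [g] covers both the start [theta / rho] and the later power
    series. *)
Lemma integral_lap_step (k : nat) (g G : R -> \bar R) :
  measurable_fun setT g -> (forall s, (0 <= g s)%E) ->
  (forall s x, \int[mu]_(v in `[x, +oo[) g (s - v)%R = G (s - x)%R)%E ->
  (forall v, (0 <= v)%R -> \int[mu]_s (((rho s)^-1)%:E * g (s - v)%R) =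
    \sum_(j <oo) (lap k j v)%:E)%E ->
  forall x, 0 <= x -> (\int[mu]_s (((rho s)^-1)%:E * G (s - x)%R) =
    \sum_(j <oo) (lap k.+1 j x)%:E)%E.
Proof.
move=> mg g0 gG gl x x0.
have rv s : 0 <= (rho s)^-1 by rewrite invr_ge0 ltW// rho_gt0.
have msub (a : R) : measurable_fun setT (fun v => a - v).
  exact: measurable_funB.
transitivity (\int[mu]_s \int[mu]_(v in `[x, +oo[)
    (((rho s)^-1)%:E * g (s - v)%R))%E.
  apply: eq_integral => s _; rewrite ge0_integralZl_EFin ?gG//.
  apply: measurable_funTS; apply: (measurableT_comp mg); exact: msub.
rewrite (@tonelli_halfline _ (fun z => ((rho z.1)^-1)%:E * g (z.1 - z.2)%R)%E).
- rewrite -integral_nneseries_lap//; apply: eq_integral => v.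
  by rewrite inE/= in_itv/= andbT => xv; rewrite gl// (le_trans x0).
- apply: emeasurable_funM.
    apply/measurable_EFinP.
    apply: (@measurableT_comp _ _ _ _ _ _ (fun s => (rho s)^-1)) => //.
    by apply: continuous_measurable_fun; exact: continuous_rhoV.
  by apply: (measurableT_comp mg); exact: measurable_funB.
- by move=> z; rewrite mule_ge0 ?lee_fin ?g0.
Qed.

Lemma integral_coef m x : 0 <= x ->
  (\int[mu]_s (((rho s)^-1)%:E * tau_series (coef m) (s - x)%R) =
   \sum_(j <oo) (lap m.+2 j x)%:E)%E.
Proof.
elim: m x => [|m IH].
  apply: (@integral_lap_step 1 (fun s => (theta s / rho s)%:E)).
  - apply/measurable_EFinP; apply: continuous_measurable_fun => s.
    by apply: cvgM; [exact: continuous_theta|exact: continuous_rhoV].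
  - by move=> s; rewrite lee_fin divr_ge0 ?theta_ge0// ltW// rho_gt0.
  - exact: integral_theta_series.
  - move=> v v0; rewrite -integral_theta_rho//; apply: eq_integral => s _.
    by rewrite -EFinM mulrC.
apply: (@integral_lap_step _ (tau_series (coef m))) => //.
- by apply: measurable_tau_series => j; exact: coef_ge0.
- by move=> s; apply: tau_series_ge0 => j; exact: coef_ge0.
- by move=> s x; rewrite integral_tau_series// => j; exact: coef_ge0.
Qed.

Lemma cvg_tauXy j : tau s ^+ j.*2.+1 / b j @[s --> +oo] --> (b j)^-1.
Proof.
rewrite -[X in _ --> X]mul1r; apply: cvgMl.
rewrite -[X in _ --> X](expr1n R j.*2.+1).
apply: (@cvg_comp _ _ _ tau (fun x => x ^+ j.*2.+1) _ _ _ cvg_tauy).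
exact: exprn_continuous.
Qed.

(** Both sides evaluate [integral_coef] at [x = 0]: termwise, [tau^(2 j + 1) / rho] has integral
    [1 / b j] over the line, while [lap m.+2 j 0] is the right-hand term. *)
Lemma nneseries_coef m :
  (\sum_(j <oo) (coef m j / b j)%:E =
   \sum_(j <oo) (m.+2%:R / b j ^+ m.+3)%:E)%E.
Proof.
transitivity (\sum_(j <oo) (lap m.+2 j (0 : R))%:E)%E; last first.
  by apply: eq_eseriesr => j _; rewrite /lap mulr0 oppr0 expR0 mul0r add0r mul1r.
rewrite -integral_coef//.
transitivity (\int[mu]_s \sum_(j <oo)
    (coef m j * (tau s ^+ j.*2.+1 / rho s))%:E)%E; last first.
  apply: eq_integral => s _; rewrite subr0 -nneseriesZl; last first.
    by move=> j _; rewrite lee_fin mulr_ge0 ?coef_ge0// exprn_ge0// tau_ge0.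
  by apply: eq_eseriesr => j _; rewrite -EFinM; congr EFin; ring.
rewrite integral_nneseries//.
- apply: eq_eseriesr => j _.
  under eq_integral do rewrite EFinM.
  rewrite ge0_integralZl_EFin ?coef_ge0//.
  + rewrite (integralT_FTC _ _ (is_derive_tauX j)
      (@cvg_tauXNy j) (@cvg_tauXy j)) -?EFinM//.
      exact: tauX_rho_ge0.
    exact: continuous_tauX_rho.
  + by move=> s _; rewrite lee_fin tauX_rho_ge0.
  + apply/measurable_EFinP; apply: continuous_measurable_fun.
    exact: continuous_tauX_rho.
- move=> j; apply/measurable_EFinP/measurable_funM => //.
  apply: continuous_measurable_fun; exact: continuous_tauX_rho.
- by move=> j s _; rewrite lee_fin mulr_ge0 ?coef_ge0// tauX_rho_ge0.
Qed.

End coefficients.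

(** * t-values and zeta values *)

Section zeta.
Context {R : realType}.
Notation b j := ((j.*2.+1)%:R : R).

Definition invX k m : R := (m.+1%:R ^+ k)^-1.

(** A telescoping bound, proved by induction from [N = 1]; the case [N = 0] is separate and uses the
    convention [0^-1 = 0]. *)
Lemma series_inv_sqr_le N : series (invX 2) N <= 2 - N%:R^-1.
Proof.
elim: N => [|[|N] IH].
- by rewrite /series /= big_geq// invr0 subr0.
- by rewrite /series /= big_nat1 /invX expr1n !invr1; lra.
rewrite /series /= big_nat_recr//=; apply: (le_trans (lerD IH (lexx _))).
rewrite /invX.
move: (N.+1%:R) (ltr0Sn R N) (natr1 N.+1 : N.+1%:R + 1 = _ :> R) => x x0 <-.
rewrite -subr_ge0.
have -> : 2 - (x + 1)^-1 - (2 - x^-1 + ((x + 1) ^+ 2)^-1) =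
    (x * (x + 1) ^+ 2)^-1.
  by field; rewrite !gt_eqF// addr_gt0.
by rewrite invr_ge0 mulr_ge0 ?sqr_ge0// ltW.
Qed.

Lemma invX_ge0 k m : 0 <= invX k m.
Proof. by rewrite invr_ge0 exprn_ge0. Qed.

Lemma is_cvg_series_invX k : (1 < k)%N -> cvgn (series (invX k)).
Proof.
move=> k1; apply: (@series_le_cvg _ _ (invX 2)).
- exact: invX_ge0.
- exact: invX_ge0.
- move=> m; rewrite lef_pV2 ?posrE ?exprn_gt0//.
  by rewrite ler_weXn2l// ler1n.
apply: nondecreasing_is_cvgn.
  by apply: nondecreasing_series => m _ _; exact: invX_ge0.
exists 2 => _ [N _ <-]; apply: (le_trans (series_inv_sqr_le N)).
by rewrite lerBlDr lerDl invr_ge0.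
Qed.

Lemma tvalueE k : tvalue k = limn (series (fun m => (b m ^+ k)^-1)).
Proof.
rewrite /tvalue; congr (limn (series _)); apply/funext => m.
by congr (_ ^+ _)^-1; rewrite -[m.+1%:R]natr1 -[b m]natr1 -mul2n natrM; lra.
Qed.

Lemma is_cvg_series_tvalue k : (1 < k)%N ->
  cvgn (series (fun m => (b m ^+ k)^-1)).
Proof.
move=> k1; apply: (series_le_cvg _ _ _ (is_cvg_series_invX k1)).
- by move=> m; rewrite invr_ge0 exprn_ge0.
- exact: invX_ge0.
- move=> m; rewrite lef_pV2 ?posrE ?exprn_gt0//.
  by rewrite ler_pXn2r ?nnegrE// ?ler_nat; lia.
Qed.

Lemma zetaE k : zeta (k%:R : R) = limn (series (invX k)).
Proof.
rewrite /zeta; congr (limn (series _)); apply/funext => m.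
by rewrite /riemannR powR_mulrn.
Qed.

(** Among the denominators 1, ..., 2 N, the even ones carry the factor [2^(-k)]. Passing to the
    limit gives [tvalue_zeta]. *)
Lemma series_invX_double k N : series (invX k) N.*2 =
  series (fun m => (b m ^+ k)^-1) N + (2 ^+ k)^-1 * series (invX k) N.
Proof.
elim: N => [|N IH]; first by rewrite /series /= !big_geq// mulr0 addr0.
rewrite doubleS /series /= !big_nat_recr//=.
move: IH; rewrite /series /= => ->.
rewrite /invX -doubleS -(mul2n N.+1) natrM exprMn invfM.
by rewrite -!addrA [in RHS]mulrDr; congr +%R; rewrite addrCA.
Qed.

Lemma tvalue_zeta k : (1 < k)%N ->
  tvalue k = (1 - 1 / 2 ^+ k) * zeta (k%:R : R).
Proof.
move=> k1; rewrite tvalueE zetaE.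
have cu := is_cvg_series_invX k1; have ct := is_cvg_series_tvalue k1.
have h1 : series (invX k) N.*2 @[N --> \oo] --> limn (series (invX k)).
  apply: (@cvg_comp _ _ _ double (series (invX k)) _ _ _ _ cu).
  apply/cvgnyPge => A; near=> N; rewrite (@leq_trans N)//; last lia.
  by near: N; exact: nbhs_infty_ge.
have h2 : series (invX k) N.*2 @[N --> \oo] -->
    limn (series (fun m => (b m ^+ k)^-1)) +
    (2 ^+ k)^-1 * limn (series (invX k)).
  under eq_fun do rewrite series_invX_double.
  by apply: cvgD; [exact: ct|exact: cvgMr].
have := cvg_unique (@norm_hausdorff _ R) h1 h2.
by rewrite mul1r mulrBl mul1r => {1}->; rewrite addrK.
Unshelve. all: by end_near. Qed.
End zeta.

(** * Summation over chains *)

Section chains.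
Context {R : realType}.
Notation b j := ((j.*2.+1)%:R : R).

(* The weight of a chain with exponents 2, 1, ..., 1. The factor 2 x - 1 is
   written [b x.-1], which is positive even at the junk value x = 0. *)
Definition chain_weight (l : seq nat) : R :=
  2^-1 ^+ (\sum_(i < (size l).-1) (nth 0%N l i == nth 0%N l i.+1))%N /
  (b (head 0%N l).-1 * \prod_(x <- l) b x.-1).

Lemma chain_weight_ge0 l : 0 <= chain_weight l.
Proof. by rewrite divr_ge0 ?exprn_ge0// mulr_ge0// prodr_ge0. Qed.

Lemma chain_weight_rcons l j : (0 < size l)%N ->
  chain_weight (rcons l j) =
  chain_weight l * (2^-1 ^+ (last 0%N l == j) / b j.-1).
Proof.
case: l => // x l _; rewrite /chain_weight rcons_cons /= size_rcons.
rewrite big_ord_recr /= -rcons_cons -cats1 big_cat big_seq1 /= cats1 exprD.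
have -> : nth 0%N (rcons (x :: l) j) (size l) = last x l.
  by rewrite nth_rcons /= ltnSn (last_nth 0%N).
have -> : nth 0%N (rcons l j) (size l) = j by rewrite nth_rcons ltnn eqxx.
have -> : (\sum_(i < size l)
    (nth 0%N (rcons (x :: l) j) i == nth 0%N (rcons l j) i) =
  \sum_(i < size l) (nth 0%N (x :: l) i == nth 0%N l i))%N.
  apply: eq_bigr => i _; rewrite !nth_rcons ltn_ord /=.
  by rewrite ltnS ltnW.
by rewrite mulf_div mulrA.
Qed.

(** Sums over the entries [j] that can follow [i] in a chain, [half_weight] discarding [j < i].
    Entries start at 1, hence the predecessor. *)
Definition transfer (w : nat -> \bar R) i : \bar R :=
  (\sum_(j <oo) ((half_weight i j / 2 / b j.-1)%:E * w j))%E.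

Lemma transfer_term_ge0 (w : nat -> \bar R) i j : (forall j, 0 <= w j)%E ->
  (0 <= (half_weight i j / 2 / b j.-1)%:E * w j)%E.
Proof.
move=> w0; rewrite mule_ge0// lee_fin divr_ge0// divr_ge0//.
exact: half_weight_ge0.
Qed.

Lemma transfer_ge0 (w : nat -> \bar R) i : (forall j, 0 <= w j)%E ->
  (0 <= transfer w i)%E.
Proof.
by move=> w0; apply: nneseries_ge0 => j _ _; exact: transfer_term_ge0.
Qed.

Lemma transferS (w : nat -> \bar R) i : (forall j, 0 <= w j)%E ->
  (transfer w i.+1 = \sum_(j <oo) ((half_weight i j / 2 / b j)%:E * w j.+1))%E.
Proof.
move=> w0; rewrite /transfer nneseries_recl//; last first.
  by move=> j _; exact: transfer_term_ge0.
rewrite half_weight0// !mul0r mul0e add0e -nneseries_addn; last first.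
  by move=> j; exact: transfer_term_ge0.
by apply: eq_eseriesr => j _; rewrite addn1 /half_weight eqSS ltnS.
Qed.

(** Exchanging the sums moves the matrix [half_weight] from [w] to [coef d], where it produces
    [halfsum (coef d) j / b j], that is [coef d.+1 j]. *)
Lemma nneseries_transfer d (w : nat -> \bar R) : (forall j, 0 <= w j)%E ->
  (\sum_(i <oo) ((coef d i / 2 ^+ d.+1)%:E * transfer w i.+1) =
   \sum_(j <oo) ((coef d.+1 j / 2 ^+ d.+2)%:E * w j.+1))%E.
Proof.
move=> w0.
have t0 i j : (0 <= (half_weight i j / 2 / b j)%:E * w j.+1)%E.
  by rewrite mule_ge0// lee_fin divr_ge0// divr_ge0// half_weight_ge0.
have c0 i : 0 <= coef d i / 2 ^+ d.+1 :> R.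
  by rewrite divr_ge0 ?coef_ge0// exprn_ge0.
transitivity (\sum_(i <oo) \sum_(j <oo)
    ((coef d i / 2 ^+ d.+1)%:E * ((half_weight i j / 2 / b j)%:E * w j.+1)))%E.
  by apply: eq_eseriesr => i _; rewrite transferS// nneseriesZl.
rewrite nneseries_interchange; last first.
  by move=> i j; apply: mule_ge0; [rewrite lee_fin|exact: t0].
apply: eq_eseriesr => j _.
transitivity (\sum_(i <oo)
    ((coef d i * half_weight i j)%:E * (((2 ^+ d.+2 * b j)^-1)%:E * w j.+1)))%E.
  apply: eq_eseriesr => i _; rewrite !muleA -!EFinM; congr (_%:E * _)%E.
  rewrite [2 ^+ d.+2]exprS; move: (od_neq0 (R := R) j); move: (b j) => B B0.
  by field; rewrite expf_neq0 ?B0.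
rewrite nneseries_half_weight; last 2 first.
- by move=> i; exact: coef_ge0.
- by rewrite mule_ge0// lee_fin invr_ge0 mulr_ge0// exprn_ge0.
rewrite muleA -EFinM; congr (_%:E * _)%E; rewrite /=.
by rewrite invfM mulrA mulrAC.
Qed.

Lemma mtv_index_rcons l j : (0 < size l)%N ->
  all (leq 1) (rcons l j) && sorted leq (rcons l j) =
  (all (leq 1) l && sorted leq l) && (last 0%N l <= j)%N.
Proof.
case: l => // x l _; rewrite all_rcons rcons_cons /= rcons_path.
have [/= /andP[x1 l1]|/=] := boolP (all (leq 1) (x :: l)); last first.
  by move=> /negbTE ->; rewrite andbF.
rewrite x1 l1 andbT /=.
case: (boolP (last x l <= j)%N) => xj; last by rewrite !andbF.
(* The new entry is positive because it is at least the last one, itself positive. *)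
rewrite (leq_trans _ xj) ?andbT//.
by have /allP := l1; case/predU1P: (mem_last x l) => [->//|xl]; exact.
Qed.

(** Induction on the length with [w] arbitrary: summing over the final entry replaces [w] by
    [transfer w] on chains one shorter. *)
Lemma esum_chain_weight d (w : nat -> \bar R) : (forall j, 0 <= w j)%E ->
  (\esum_(t in @mtv_index d.+1) ((chain_weight t)%:E * w (last 0%N t)) =
   \sum_(j <oo) ((coef d j / 2 ^+ d.+1)%:E * w j.+1))%E.
Proof.
elim: d w => [|d IH] w w0.
  rewrite (reindex_esum setT _ (fun j => [tuple j.+1])); last first.
    split.
    - by move=> j _; rewrite /mtv_index /=.
    - by move=> i j _ _ /(congr1 val) [].
    - move=> t; rewrite /mtv_index /= => /andP[t1 _].
      exists (thead t).-1 => //; apply: val_inj => /=.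
      case: t t1 => -[|[|x] [|y l]] //= t0 _.
  rewrite nneseries_esumT; last first.
    by move=> j; rewrite mule_ge0// lee_fin divr_ge0 ?coef_ge0// exprn_ge0.
  apply: eq_esum => j _; congr (_%:E * _)%E.
  rewrite /chain_weight /= big_ord0 big_seq1 expr0 expr1 /=.
  by move: (od_neq0 (R := R) j); move: (b j) => B B0; field.
rewrite -nneseries_transfer// -IH; last by move=> j; exact: transfer_ge0.
(* A chain is a shorter chain together with a final entry at least as large as its last one. *)
rewrite (reindex_esum
  ((@mtv_index d.+1) `*``
    (fun t : d.+1.-tuple nat => [set j | (last 0%N t <= j)%N]))
  _ (fun k => [tuple of rcons k.1 k.2])); last first.
  split.
  - move=> [t j] /= [tI tj].
    by rewrite /mtv_index /= mtv_index_rcons ?size_tuple// tj andbT.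
  - move=> [t j] [t' j'] _ _ /= /(congr1 val) /= /rcons_inj [/val_inj -> ->] //.
  - case=> l sl; rewrite /mtv_index /=.
    case/lastP: l sl => // l j sl.
    have sl' : size l == d.+1 by rewrite size_rcons eqSS in sl.
    rewrite mtv_index_rcons ?(eqP sl')// => /andP[lI lj].
    by exists (Tuple sl', j); [split|exact: val_inj].
rewrite -(esum_esum (a := fun (t : d.+1.-tuple nat) j =>
  ((chain_weight (rcons t j))%:E * w (last 0%N (rcons t j)))%E)); last first.
  by move=> t j _ _; rewrite mule_ge0// lee_fin chain_weight_ge0.
apply: eq_esum => t _.
rewrite -(nneseries_esum (P := fun j => (last 0%N t <= j)%N)); last first.
  by move=> j _; rewrite mule_ge0// lee_fin chain_weight_ge0.
rewrite eseries_mkcond -nneseriesZl; last first.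
  by move=> j _; exact: transfer_term_ge0.
apply: eq_eseriesr => j _; case: ifPn => [tj|].
  rewrite last_rcons chain_weight_rcons ?size_tuple// half_weightE//.
  by rewrite muleA -EFinM.
by rewrite -ltnNge => jt; rewrite half_weight0// !mul0r mul0e mule0.
Qed.

(** [chain_weight] gives the last entry exponent 1; the other factor of the final exponent 2 is
    split off, to serve as the test function [w]. *)
Lemma mtv_term_chain_weight n (t : n.+2.-tuple nat) : mtv_index t ->
  mtv_term (2^-1 : R) [tuple of 2%N :: rcons (nseq n 1%N) 2%N] t =
  chain_weight t / b (last 0%N t).-1.
Proof.
rewrite /mtv_index /= => /andP[t1 _].
have tE i : 2 * (tnth t i)%:R - 1 = b (tnth t i).-1.
  have : (1 <= tnth t i)%N by have /allP := t1; apply; exact: mem_tnth.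
  case: (tnth t i) => // m _.
  by rewrite /= -[m.+1%:R]natr1 -[b m]natr1 -mul2n natrM; ring.
rewrite /mtv_term /chain_weight size_tuple -mulrA -invfM; congr (_ / _).
transitivity (\prod_(i < n.+2)
    b (tnth t i).-1 ^+ nth 0%N (2%N :: rcons (nseq n 1%N) 2%N) i).
  by apply: eq_bigr => i _; rewrite -tE; congr (_ ^+ _); exact: tnth_nth.
rewrite big_tuple [in LHS]big_ord_recl [in LHS]big_ord_recr /=.
rewrite [in RHS]big_ord_recl [in RHS]big_ord_recr /=.
rewrite nth_rcons size_nseq ltnn eqxx.
have -> : \prod_(i < n) b (tnth t (lift ord0 (widen_ord (leqnSn n) i))).-1 ^+
      nth 0%N (rcons (nseq n 1%N) 2%N) i =
    \prod_(i < n) b (tnth t (lift ord0 (widen_ord (leqnSn n) i))).-1.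
  apply: eq_bigr => i _; rewrite nth_rcons size_nseq ltn_ord nth_nseq ltn_ord.
  by rewrite expr1.
have -> : head 0%N t = tnth t ord0 by rewrite (tnth_nth 0%N) nth0.
have -> : last 0%N t = tnth t (lift ord0 ord_max).
  by rewrite (tnth_nth 0%N) -nth_last size_tuple.
by rewrite !expr2; ring.
Qed.

End chains.

(** * Evaluation of the interpolated t-value *)

Theorem theorem5p1 (R : realType) (n : nat) :
  mtv (2^-1 : R) [tuple of 2%N :: rcons (nseq n 1%N) 2%N] =
    ((n + 3)%:R / 2 ^+ (n + 2) * tvalue (n + 4))%:E
  /\
  (n + 3)%:R / 2 ^+ (n + 2) * tvalue (n + 4) =
    (n + 3)%:R / 2 ^+ (n + 2) * (1 - 1 / 2 ^+ (n + 4)) *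
      zeta ((n + 4)%:R : R).
Proof.
split; last by rewrite tvalue_zeta ?mulrA// addn4.
have tc k : (1 < k)%N ->
    (\sum_(j <oo) ((j.*2.+1%:R ^+ k)^-1)%:E = (tvalue k : R)%:E)%E.
  by move=> k1; apply: nneseries_EFin; rewrite tvalueE; exact: is_cvg_series_tvalue.
pose w (j : nat) : \bar R := ((j.-1.*2.+1%:R)^-1)%:E.
have w0 j : (0 <= w j)%E by rewrite lee_fin invr_ge0.
(* All terms are nonnegative at 1/2, so the sum of negative parts is zero. *)
rewrite /mtv [X in (_ - X)%E]esum1 ?sube0; last first.
  move=> t tI; rewrite funenegE /= mtv_term_chain_weight// max_r//.
  by rewrite lee_fin oppr_le0 divr_ge0 ?chain_weight_ge0.
transitivity (\esum_(t in @mtv_index n.+2)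
    ((chain_weight t)%:E * w (last 0%N t)))%E.
  apply: eq_esum => t tI; rewrite funeposE /= mtv_term_chain_weight// max_l//.
  by rewrite lee_fin divr_ge0 ?chain_weight_ge0.
rewrite esum_chain_weight// addn2 addn3 addn4.
(* Chains of length [n + 2] bring [coef n.+1] and the power of 2; [w] supplies the last [1 / b j],
   as [nneseries_coef] requires. *)
transitivity (((2 ^+ n.+2)^-1 : R)%:E *
    \sum_(j <oo) (coef n.+1 j / (j.*2.+1)%:R : R)%:E)%E.
  rewrite -nneseriesZl; last first.
    by move=> j _; rewrite lee_fin divr_ge0 ?coef_ge0.
  by apply: eq_eseriesr => j _; rewrite /w /= -!EFinM mulrAC mulrC mulrA.
rewrite nneseries_coef EFinM -tc// mulrC EFinM -muleA; congr (_ * _)%E.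
by rewrite -nneseriesZl// => j _; rewrite lee_fin invr_ge0 exprn_ge0.
Qed.
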